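(* Let $L_0>0$, $\delta_1\in(1,\infty)$, and $J\in\mathbb{N}$. Set $\delta=\frac{1}{\sqrt{\delta_1}}$, $S_0=0$, and $S_j=S_{j-1}+\delta^{\,j-2^{j-1}}$ for $j=1,\dots,J$. Let $(f_0,f_0',f_0'')=(0,-L_0/2,0)$ and, for $j=1,\dots,J$, $$(f_j,f_j',f_j'')=\left(-\frac{L_0}{3}\sum_{k=0}^{j-1}\left(\delta^{\,k+2-2^{k+1}}\right)^3,\ -\frac{L_0}{2}\left(\delta^{\,j+2-2^{j+1}}\right)^2,\ 0\right).$$ Let $\Delta=\frac{1-\delta}{2}$ and let $F_J:\mathbb{R}\to\mathbb{R}$ be the function built from $(S_j)$, $(f_j,f_j',f_j'')$ and $\Delta$ as described in the context. Let $\theta_0=0$ and let $\theta_1,\dots,\theta_J$ be generated by the cubic regularized Newton's method with parameters $L_0,\delta_1$ (described in the context) applied to $F=F_J$. Then, for each $j=1,\dots,J$, the total number of objective function evaluations taken by the method upon acceptance of the iterate $\theta_j$ is $2^j$.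
   Context: $\dot F,\ddot F$ denote first and second derivatives; $\mathbb{N}=\{1,2,\dots\}$. Construction of $F_J$: given $S_0<\dots<S_J$, triples $(f_j,f_j',f_j'')\in\mathbb{R}^3$ and $\Delta>0$ such that the intervals $[S_j-\Delta,S_j+\Delta]$ are pairwise disjoint, for each $j\in\{0,\dots,J\}$ let $P_j$ be a polynomial of degree $9$ with $P_j,\dot P_j,\ddot P_j$ vanishing at $S_j\pm\Delta$ and $P_j(S_j)=f_j$, $\dot P_j(S_j)=f_j'$, $\ddot P_j(S_j)=f_j''$ (such polynomials exist). Set $F_J(\theta)=P_j(\theta)$ for $\theta\in[S_j-\Delta,S_j+\Delta]$, $j=0,\dots,J$, and $F_J(\theta)=0$ otherwise. Cubic regularized Newton's method (one-dimensional case) with parameters $L_0>0$, $\delta_1>1$ and initial point $\theta_0$: for $k=0,1,2,\dots$, set $M_0^k=L_0$ and, for $\ell=0,1,2,\dots$, let $$U_k(\psi;M_\ell^k)=\dot F(\theta_k)(\psi-\theta_k)+\tfrac12\ddot F(\theta_k)(\psi-\theta_k)^2+\tfrac16M_\ell^k|\psi-\theta_k|^3,$$ let $\psi_\ell^k$ be a global minimizer of $U_k(\cdot\,;M_\ell^k)$ over $\mathbb{R}$; if $F(\psi_\ell^k)\le F(\theta_k)+U_k(\psi_\ell^k;M_\ell^k)$, accept $\theta_{k+1}=\psi_\ell^k$ and proceed to the next $k$; otherwise set $M_{\ell+1}^k=\delta_1M_\ell^k$ and continue with $\ell+1$. Counting convention: one evaluation is counted for $F(\theta_0)$ and one for the value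 of $F$ at each trial point $\psi_\ell^k$; the value $F(\theta_k)$ for $k\ge1$, already computed when $\theta_k$ was accepted, is not counted again. *)

(* Defs.v *)
From HB Require Import structures.
From mathcomp Require Import all_boot all_order all_algebra.
From mathcomp Require Import all_classical all_reals all_analysis.
Set Implicit Arguments.
Unset Strict Implicit.
Unset Printing Implicit Defensive.
Import Order.TTheory GRing.Theory Num.Theory.
Import numFieldNormedType.Exports.
Local Open Scope ring_scope.

Section Interpolant.
Variable R : realType.

(* [size P <= 10] reads "polynomial of degree 9" as degree at most 9: the nine
   conditions may well be met by a polynomial of lower degree. *)
Definition bump_poly (S Delta : R) (data : R * R * R) (P : {poly R}) : Prop :=
  let: (f, f', f'') := data in
  [/\ (size P <= 10)%N,
      [/\ P.[S - Delta] = 0, (deriv P).[S - Delta] = 0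
        & (deriv (deriv P)).[S - Delta] = 0],
      [/\ P.[S + Delta] = 0, (deriv P).[S + Delta] = 0
        & (deriv (deriv P)).[S + Delta] = 0]
    & [/\ P.[S] = f, (deriv P).[S] = f' & (deriv (deriv P)).[S] = f'']].

(* The intervals being pairwise disjoint, at most one index can be picked. *)
Definition bump_fun (J : nat) (S : nat -> R) (Delta : R)
    (P : 'I_J.+1 -> {poly R}) (theta : R) : R :=
  if [pick j : 'I_J.+1 | S j - Delta <= theta <= S j + Delta] is Some j
  then (P j).[theta] else 0.

End Interpolant.

Section CubicRegularizedNewton.
Variables (R : realType) (F : R -> R).

Definition cubic_model (theta M psi : R) : R :=
  derive1 F theta * (psi - theta)
  + 2^-1 * derive1n 2 F theta * (psi - theta) ^+ 2
  + 6^-1 * M * `|psi - theta| ^+ 3.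

Definition global_minimizer (U : R -> R) (psi : R) : Prop :=
  forall x, U psi <= U x.

(* State before a trial point is computed: [iterno] is k, [iterate] is theta_k,
   [reg] is M_l^k, and [nevals] counts the evaluations of F made so far. *)
Record crn_state := CrnState {
  iterno : nat;
  iterate : R;
  reg : R;
  nevals : nat
}.

(* One trial point, hence one evaluation of F. *)
Definition crn_step (L0 delta1 : R) (s s' : crn_state) : Prop :=
  let: CrnState k theta M n := s in
  exists2 psi, global_minimizer (cubic_model theta M) psi &
    if F psi <= F theta + cubic_model theta M psi
    then s' = CrnState k.+1 psi L0 n.+1
    else s' = CrnState k theta (delta1 * M) n.+1.

(* The initial count 1 is the evaluation of F at theta_0. The method has no
   stopping rule, so an execution is infinite; it is a relation and not a
   function because a cubic model may have several global minimizers. *)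
Definition crn_execution (L0 delta1 theta0 : R) (s : nat -> crn_state) : Prop :=
  s 0%N = CrnState 0 theta0 L0 1 /\
  forall t, crn_step L0 delta1 (s t) (s t.+1).

(* The trial point of step [t] is accepted as theta_j. *)
Definition accepts (s : nat -> crn_state) (t j : nat) : Prop :=
  (iterno (s t)).+1 = j /\ iterno (s t.+1) = j.

End CubicRegularizedNewton.

Section Counterexample.
Variable R : realType.

Fixpoint node (delta : R) (j : nat) : R :=
  if j is i.+1 then node delta i + delta ^ (j%:Z - (2 ^ i)%N%:Z) else 0.

Definition node_data (L0 delta : R) (j : nat) : R * R * R :=
  if j is 0%N then (0, - (L0 / 2), 0)
  else (- (L0 / 3) * \sum_(0 <= k < j) (delta ^ (k%:Z + 2 - (2 ^ k.+1)%N%:Z)) ^+ 3,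
        - (L0 / 2) * (delta ^ (j%:Z + 2 - (2 ^ j.+1)%N%:Z)) ^+ 2,
        0).

End Counterexample.

(* Main.v *)
Require Import Defs.
From HB Require Import structures.
From mathcomp Require Import all_boot all_order all_algebra.
From mathcomp Require Import all_classical all_reals all_analysis.
From mathcomp Require Import zify ring lra.
Set Implicit Arguments.
Unset Strict Implicit.
Unset Printing Implicit Defensive.
Import Order.TTheory GRing.Theory Num.Theory.
Import numFieldNormedType.Exports.
Local Open Scope ring_scope.

(** Write d for delta, so that delta1 = d^-2, and let g_j = d ^ (j + 1 - 2^j) be
    the distance from the node S_j to the next one; g_j >= 1 > 2 * Delta because
    j + 1 <= 2^j, so the bumps are disjoint.

    At S_j the prescribed second derivative is 0 and the first one is
    -(L0/2) g_{j+1}^2.  The cubic model with M = L0 d^(-2l) then has exactly one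
    global minimizer, S_j + g_{j+1} d^l ([cubic_model_min]), where it takes the
    value -(L0/3) g_{j+1}^3 d^l ([cubic_model_minE]).

    Since g_{j+1} d^(2^j - 1) = g_j, trial number l = 2^j - 1 lands exactly on
    S_{j+1}; there the prescribed decrease of F is (L0/3) g_{j+1}^3, at least
    what the model predicts, and the trial is accepted.  A trial with a smaller
    l overshoots S_{j+1} by at least 1 - d > Delta, yet stays at least 1 short
    of S_{j+2} because the distance to S_{j+2} is g_j + g_{j+1}.  It falls
    between two bumps, where F = 0 ([F_trial]), whereas the model predicts a
    negative value (F(S_j) <= 0): it is rejected.  One step is thus
    [crn_step_bumps].

    Hence exactly 2^j evaluations are spent between the acceptances of S_j and
    of S_{j+1}, and with the initial one the count at S_j is
    1 + (1 + 2 + ... + 2^(j-1)) = 2^j.  As each step of a run costs one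
    evaluation, this says that step number 2^j - 1 starts from S_j
    ([crn_at_node]). *)

(** * The cubic model at an inflection point *)

Section Model.
Variable R : realType.

(** For u >= 0 the left-hand side is (u - d)^2 (u + 2d); for u < 0 it is a sum
    of positive terms. It is the scaled excess of the model over its minimum. *)
Lemma cubic_tangent_min (d u : R) : 0 < d ->
  `|u| ^+ 3 - 3 * d ^+ 2 * u + 2 * d ^+ 3 <= 0 -> u = d.
Proof.
move=> d0; have [u0|u0] := ger0P u => h; last first.
  have : 0 < d ^+ 2 * (- u) by rewrite mulr_gt0 ?exprn_gt0 ?oppr_gt0.
  have : 0 < d ^+ 3 by rewrite exprn_gt0.
  have : 0 < (- u) ^+ 3 by rewrite exprn_gt0 ?oppr_gt0.
  nra.
have E : u ^+ 3 - 3 * d ^+ 2 * u + 2 * d ^+ 3 = (u - d) ^+ 2 * (u + 2 * d).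
  by ring.
have ud : 0 < u + 2 * d by rewrite ltr_wpDl// mulr_gt0.
move: h; rewrite E pmulr_lle0// => h.
by apply/eqP; rewrite -subr_eq0 -sqrf_eq0 eq_le h sqr_ge0.
Qed.

(** With vanishing curvature, the minimizer d is the positive root of
    (M / 2) u^2 = - F'(theta), so the slope is parametrized by d. *)
Lemma cubic_model_min (F : R -> R) (theta M d psi : R) : 0 < M -> 0 < d ->
  derive1 F theta = - (M / 2) * d ^+ 2 -> derive1n 2 F theta = 0 ->
  global_minimizer (cubic_model F theta M) psi -> psi = theta + d.
Proof.
move=> M0 d0 F1 F2 /(_ (theta + d)); rewrite /cubic_model F1 F2 => h.
rewrite -(subrK theta psi) addrC; congr (_ + _).
apply: (cubic_tangent_min d0).
rewrite -(pmulr_rle0 _ (_ : 0 < M / 6)) ?divr_gt0//.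
move: h; rewrite [theta + d]addrC addrK (gtr0_norm d0).
by move: (`|_| ^+ 3) => c; lra.
Qed.

Lemma cubic_model_minE (F : R -> R) (theta M d : R) : 0 < d ->
  derive1 F theta = - (M / 2) * d ^+ 2 -> derive1n 2 F theta = 0 ->
  cubic_model F theta M (theta + d) = - (M / 3) * d ^+ 3.
Proof.
move=> d0 F1 F2; rewrite /cubic_model F1 F2 [theta + d]addrC addrK gtr0_norm//.
by field.
Qed.

End Model.

(** * Functions built from separated bumps *)

Section Bumps.
Variable R : realType.

(** Differentiability is a local matter, and an open interval is a
    neighbourhood of its points; stating the conclusion on the whole interval
    lets the lemma be applied to its own result for second derivatives. *)
Lemma derive1_itv_horner (F : R -> R) (p : {poly R}) (a b : R) :
  (forall x, a < x < b -> F x = p.[x]) ->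
  forall x, a < x < b -> derive1 F x = (deriv p).[x].
Proof.
move=> Fp x xab; rewrite derivE !derive1E; apply: near_eq_derive.
have xI : x \in `]a, b[ by rewrite in_itv.
by apply: filterS (near_in_itvoo xI) => y; rewrite in_itv/=; exact: Fp.
Qed.

Variables (S : nat -> R) (Delta : R) (J : nat) (P : 'I_J.+1 -> {poly R}).
Hypothesis S_sep : forall i k, (i < k)%N -> S i + 1 <= S k.
Hypothesis Delta_gt0 : 0 < Delta.
Hypothesis Delta_lt : Delta < 2^-1.

Lemma bump_fun_in (j : 'I_J.+1) (x : R) :
  S j - Delta <= x <= S j + Delta -> bump_fun S Delta P x = (P j).[x].
Proof.
move=> xj; rewrite /bump_fun; case: pickP => [i|/(_ j)]; last by rewrite xj.
move: xj => /andP[? ?] /andP[? ?]; have hD := Delta_lt.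
suff -> : i = j by [].
apply: val_inj => /=; have [/S_sep|/S_sep|//] := ssrnat.ltngtP i j => ?; exfalso; lra.
Qed.

(** The nodes increase, so a point between two consecutive bumps avoids all
    the bumps. The index [i] may exceed [J]: only some of the intervals carry a
    bump, and the point is outside all of them. *)
Lemma bump_fun_out (i : nat) (x : R) :
  S i + Delta < x -> x < S i.+1 - Delta -> bump_fun S Delta P x = 0.
Proof.
move=> ix xi; rewrite /bump_fun; case: pickP => // j /andP[? ?]; exfalso.
have hD := Delta_gt0.
have [ji|ij] := leqP j i.
  have : S j <= S i by move: ji; rewrite leq_eqVlt => /predU1P[->//|/S_sep]; lra.
  lra.
have : S i.+1 <= S j by move: ij; rewrite leq_eqVlt => /predU1P[->//|/S_sep]; lra.
lra.
Qed.

Lemma bump_fun_derive1 (j : 'I_J.+1) :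
  derive1 (bump_fun S Delta P) (S j) = (deriv (P j)).[S j].
Proof.
have hD := Delta_gt0.
apply: (@derive1_itv_horner _ _ (S j - Delta) (S j + Delta)); last by lra.
by move=> x xj; apply: bump_fun_in; lra.
Qed.

Lemma bump_fun_derive2 (j : 'I_J.+1) :
  derive1n 2 (bump_fun S Delta P) (S j) = (deriv (deriv (P j))).[S j].
Proof.
have hD := Delta_gt0.
apply: (@derive1_itv_horner _ _ (S j - Delta) (S j + Delta)); last by lra.
apply: derive1_itv_horner => x xj.
by apply: bump_fun_in; lra.
Qed.

End Bumps.

(** * The nodes and their gaps *)

Section Nodes.
Variables (R : realType) (d : R).

Definition gap (j : nat) : R := d ^ (j.+1%:Z - (2 ^ j)%N%:Z).

Lemma nodeS j : node d j.+1 = node d j + gap j.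
Proof. by []. Qed.

(** Two simplifications: the powers in the data are gaps with shifted index, and
    the separate case of node 0 obeys the general formula since [gap 1 = 1]. *)
Lemma node_dataE (L0 : R) j : node_data L0 d j =
  (- (L0 / 3) * \sum_(0 <= k < j) gap k.+1 ^+ 3, - (L0 / 2) * gap j.+1 ^+ 2, 0).
Proof.
have gapE k : d ^ (k%:Z + 2 - (2 ^ k.+1)%N%:Z) = gap k.+1.
  by rewrite /gap; congr (_ ^ _); lia.
case: j => [|j]; last first.
  by rewrite /node_data gapE; under eq_bigr do rewrite gapE.
by rewrite /= big_nil mulr0 /gap subrr expr0z expr1n mulr1.
Qed.

Hypothesis d_gt0 : 0 < d.
Hypothesis d_lt1 : d < 1.

Lemma gap_ge1 j : 1 <= gap j.
Proof.
have lej : (j.+1 <= 2 ^ j)%N by exact: ltn_expl.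
rewrite /gap (_ : _ - _ = - (2 ^ j - j.+1)%N%:Z); last by lia.
by rewrite -exprz_inv exprn_ege1// invf_ge1// ltW.
Qed.

Lemma gap_gt0 j : 0 < gap j.
Proof. exact: lt_le_trans ltr01 (gap_ge1 j). Qed.

(** This identity fixes the exponents in the construction: the first trial step
    from node [j] has length [gap j.+1], each rejection shrinks it by the factor
    [d], and after [2 ^ j - 1] rejections it reaches the next node. *)
Lemma gapS_mulX j : gap j.+1 * d ^+ (2 ^ j).-1 = gap j.
Proof.
rewrite /gap -[d ^+ _]/(d ^ (2 ^ j).-1%:Z) -expfzDr ?gt_eqF//; congr (_ ^ _).
by have := expn_gt0 2 j; rewrite expnS; lia.
Qed.

Lemma gapS_mulX_le j l : gap j.+1 * d ^+ l <= gap j.+1.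
Proof. by rewrite ler_piMr ?(ltW (gap_gt0 _))// exprn_ile1// ltW. Qed.

(** One rejection earlier the step is [gap j / d], and
    gap j / d - gap j = (gap j / d) (1 - d) >= 1 - d, twice the half-width of
    a bump. *)
Lemma gapS_mulX_ge j l : (l < (2 ^ j).-1)%N ->
  gap j + (1 - d) <= gap j.+1 * d ^+ l.
Proof.
move=> lj; pose x := gap j.+1 * d ^+ (2 ^ j).-2.
have xd : x * d = gap j.
  by rewrite -gapS_mulX -[in RHS](prednK (leq_ltn_trans (leq0n l) lj)) exprSr mulrA.
have le_x : x <= gap j.+1 * d ^+ l.
  by rewrite ler_pM2l ?gap_gt0// ler_wiXn2l ?ltW//; lia.
have := gap_ge1 j; rewrite -xd => x1; have hd := d_lt1.
(* x (1 - d) - (1 - d) = (x d - 1) (1 - d) + x (1 - d)^2 *)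
apply: le_trans le_x; have : 0 <= (x * d - 1) * (1 - d) by rewrite mulr_ge0; lra.
have : 0 <= x * (1 - d) ^+ 2.
  by rewrite mulr_ge0 ?sqr_ge0// mulr_ge0 ?exprn_ge0 ?(ltW (gap_gt0 _)) ?ltW.
nra.
Qed.

Lemma node_sep i k : (i < k)%N -> node d i + 1 <= node d k.
Proof.
elim: k => // k IHk; rewrite ltnS leq_eqVlt nodeS => /predU1P[->|/IHk].
  by rewrite lerD2l gap_ge1.
by have := gap_ge1 k; lra.
Qed.

End Nodes.

(** * Runs of the method *)

Section Run.
Variables (R : realType) (F : R -> R) (L0 delta1 theta0 : R).
Variable s : nat -> crn_state R.
Hypothesis s_run : crn_execution F L0 delta1 theta0 s.

Lemma crn_nevals t : nevals (s t) = t.+1.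
Proof.
elim: t => [|t]; first by rewrite s_run.1.
have [_ /(_ t)] := s_run; case: (s t) => k theta M n /= [psi _].
by case: ifP => _ -> /= ->.
Qed.

Lemma crn_iterno_homo : {homo (fun t => iterno (s t)) : t u / (t <= u)%N}.
Proof.
apply: homo_leq => [//|? ? ?|t /=]; first exact: leq_trans.
have [_ /(_ t)] := s_run; case: (s t) => k theta M n /= [psi _].
by case: ifP => _ -> /=.
Qed.

(** The iteration number never decreases, so it passes from [j.-1] to [j] at
    most once. *)
Lemma crn_accepts_uniq t u j : accepts s t j -> accepts s u j -> t = u.
Proof.
move=> [t1 t2] [u1 u2].
by have [/crn_iterno_homo|/crn_iterno_homo|//] := ssrnat.ltngtP t u => /=; lia.
Qed.

End Run.

(** * The run on the bump function *)

Section RunOnBumps.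
Variables (R : realType) (L0 d : R) (J : nat) (P : 'I_J.+1 -> {poly R}).
Hypothesis L0_gt0 : 0 < L0.
Hypothesis d_gt0 : 0 < d.
Hypothesis d_lt1 : d < 1.
Let Delta := (1 - d) / 2.
Let F := bump_fun (node d) Delta P.
Hypothesis P_bump :
  forall j : 'I_J.+1, bump_poly (node d j) Delta (node_data L0 d j) (P j).

Let Delta_gt0 : 0 < Delta. Proof. by have hd := d_lt1; rewrite /Delta; lra. Qed.
Let Delta_lt : Delta < 2^-1. Proof. by have hd := d_gt0; rewrite /Delta; lra. Qed.
Let d_sep := node_sep d_gt0 d_lt1.

Lemma F_node j : (j <= J)%N ->
  [/\ F (node d j) = - (L0 / 3) * \sum_(0 <= k < j) gap d k.+1 ^+ 3,
      derive1 F (node d j) = - (L0 / 2) * gap d j.+1 ^+ 2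
    & derive1n 2 F (node d j) = 0].
Proof.
rewrite -ltnS => jJ; have := P_bump (Ordinal jJ).
rewrite node_dataE => -[_ _ _ /= [f0 f1 f2]]; have hD := Delta_gt0; split.
- by rewrite /F (bump_fun_in _ d_sep Delta_lt (j := Ordinal jJ))//=; lra.
- by rewrite -f1; exact: (bump_fun_derive1 _ d_sep _ _ (Ordinal jJ)).
- by rewrite -f2; exact: (bump_fun_derive2 _ d_sep _ _ (Ordinal jJ)).
Qed.

Lemma F_trial j l : (l < (2 ^ j).-1)%N ->
  F (node d j + gap d j.+1 * d ^+ l) = 0.
Proof.
move=> lj; have hd := d_lt1; apply: (bump_fun_out _ d_sep Delta_gt0 (i := j.+1)).
  by have := gapS_mulX_ge d_gt0 d_lt1 lj; rewrite nodeS /Delta; lra.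
have := gapS_mulX_le d_gt0 d_lt1 j l; have := gap_ge1 d_gt0 d_lt1 j.
by rewrite !nodeS; have := Delta_lt; lra.
Qed.

(** One step from node [j] after [l] rejections: the method is deterministic here
    because the minimizer of the model is unique. *)
Lemma crn_step_bumps j l n s' : (j < J)%N -> (l <= (2 ^ j).-1)%N ->
  crn_step F L0 (d ^- 2) (CrnState j (node d j) (L0 * (d ^- 2) ^+ l) n) s' ->
  s' = if (l < (2 ^ j).-1)%N
       then CrnState j (node d j) (L0 * (d ^- 2) ^+ l.+1) n.+1
       else CrnState j.+1 (node d j.+1) L0 n.+1.
Proof.
move=> jJ lj [psi psi_min].
have [Fj F1 F2] := F_node (ltnW jJ).
set M := L0 * _ in psi_min *; pose h := gap d j.+1 * d ^+ l.
have M0 : 0 < M by rewrite mulr_gt0// exprn_gt0// invr_gt0 exprn_gt0.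
have h0 : 0 < h by rewrite mulr_gt0 ?gap_gt0 ?exprn_gt0.
have d0 : d ^+ l != 0 by rewrite expf_neq0// gt_eqF.
have Ml : M = L0 / (d ^+ l) ^+ 2 by rewrite /M exprVn -!exprM mulnC.
(* The slope at the node, expressed with M, is the one whose minimizer is h. *)
have F1h : derive1 F (node d j) = - (M / 2) * h ^+ 2.
  by rewrite F1 Ml /h; field.
have {psi_min} -> := cubic_model_min M0 h0 F1h F2 psi_min.
rewrite (cubic_model_minE h0 F1h F2).
have Mh : - (M / 3) * h ^+ 3 = - (L0 / 3) * gap d j.+1 ^+ 3 * d ^+ l.
  by rewrite Ml /h; field.
have g3 k : 0 < gap d k ^+ 3 by rewrite exprn_gt0 ?gap_gt0.
have sum_ge0 : 0 <= \sum_(0 <= k < j) gap d k.+1 ^+ 3.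
  by apply: sumr_ge0 => k _; exact: ltW.
case: ltnP => [lt_l|ge_l].
  (* F vanishes at the trial point; F at the node is at most 0 and the model
     value is negative. *)
  rewrite F_trial// Fj Mh lt_geF; last first.
    rewrite -mulrA -mulrDr mulNr oppr_lt0 mulr_gt0 ?divr_gt0//.
    exact: ltr_wpDl sum_ge0 (mulr_gt0 (g3 _) (exprn_gt0 _ d_gt0)).
  by move=> ->; rewrite /M mulrCA -exprS.
have -> : node d j + h = node d j.+1.
  by rewrite /h (_ : l = (2 ^ j).-1) ?gapS_mulX//; lia.
have [FS _ _] := F_node jJ.
rewrite Mh Fj FS big_nat_recr//= ifT//.
(* The actual decrease is d ^- l >= 1 times the predicted one. *)
rewrite -[_ * _ * d ^+ l]mulrA -mulrDr !mulNr lerN2 ler_pM2l ?divr_gt0//.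
by rewrite lerD2l ler_piMr ?exprn_ile1 ?ltW.
Qed.

Variable s : nat -> crn_state R.
Hypothesis s_run : crn_execution F L0 (d ^- 2) 0 s.

Lemma crn_trials j l : (j < J)%N -> (l <= (2 ^ j).-1)%N ->
  s (2 ^ j).-1 = CrnState j (node d j) L0 (2 ^ j) ->
  s ((2 ^ j).-1 + l)%N =
    CrnState j (node d j) (L0 * (d ^- 2) ^+ l) (2 ^ j + l).
Proof.
move=> jJ lj s0; elim: l lj => [|l IHl] lj; first by rewrite !addn0 expr0 mulr1.
have := s_run.2 ((2 ^ j).-1 + l)%N; rewrite IHl 1?ltnW//.
by move/(crn_step_bumps jJ (ltnW lj)); rewrite lj !addnS.
Qed.

(** The [2 ^ j] trials from node [j] take steps [2 ^ j - 1] to [2 ^ j.+1 - 2]. *)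
Lemma crn_at_node j : (j <= J)%N ->
  s (2 ^ j).-1 = CrnState j (node d j) L0 (2 ^ j).
Proof.
elim: j => [|j IHj] jJ; first exact: s_run.1.
have := s_run.2 ((2 ^ j).-1 + (2 ^ j).-1)%N.
rewrite (crn_trials jJ (leqnn _) (IHj (ltnW jJ))).
move/(crn_step_bumps jJ (leqnn _)); rewrite ltnn.
have -> : ((2 ^ j).-1 + (2 ^ j).-1).+1 = (2 ^ j.+1).-1.
  by have := expn_gt0 2 j; rewrite expnS; lia.
move=> ->; congr CrnState.
by have := expn_gt0 2 j; rewrite expnS; lia.
Qed.

Lemma crn_accepts_at j : (0 < j <= J)%N -> accepts s (2 ^ j).-2 j.
Proof.
case: j => // j /= jJ.
have e : ((2 ^ j).-1 + (2 ^ j).-1)%N = (2 ^ j.+1).-2.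
  by have := expn_gt0 2 j; rewrite expnS; lia.
have e1 : (2 ^ j.+1).-2.+1 = (2 ^ j.+1).-1.
  by have := expn_gt0 2 j; rewrite expnS; lia.
rewrite /accepts e1 (crn_at_node jJ) -e.
by rewrite (crn_trials jJ (leqnn _) (crn_at_node (ltnW jJ))).
Qed.

End RunOnBumps.

Theorem proposition4p4 (R : realType) (L0 delta1 : R) (J : nat)
    (hL0 : 0 < L0) (hdelta1 : 1 < delta1) (hJ : (1 <= J)%N)
    (P : 'I_J.+1 -> {poly R}) (s : nat -> crn_state R) :
  let delta := 1 / Num.sqrt delta1 in
  let S := node delta in
  let Delta := (1 - delta) / 2 in
  let F := bump_fun S Delta P in
  (forall j : 'I_J.+1, bump_poly (S j) Delta (node_data L0 delta j) (P j)) ->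
  crn_execution F L0 delta1 0 s ->
  forall j : nat, (1 <= j <= J)%N ->
    (exists t, accepts s t j) /\
    (forall t, accepts s t j -> nevals (s t.+1) = (2 ^ j)%N).
Proof.
move=> delta S Delta F P_bump s_run j jJ.
have delta1_gt0 : 0 < delta1 by exact: lt_trans hdelta1.
have d_gt0 : 0 < delta by rewrite divr_gt0// sqrtr_gt0.
have d_lt1 : delta < 1.
  by rewrite /delta div1r invf_lt1 ?sqrtr_gt0// -sqrtr1 ltr_sqrt.
have d2 : delta1 = delta ^- 2.
  by rewrite /delta div1r exprVn invrK sqr_sqrtr// ltW.
have run2 : crn_execution F L0 (delta ^- 2) 0 s by rewrite -d2.
have acc := crn_accepts_at hL0 d_gt0 d_lt1 P_bump run2 jJ.
split=> [|t /(crn_accepts_uniq s_run acc) <-]; first by exists (2 ^ j).-2.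
rewrite (crn_nevals s_run).
by case: j {acc} jJ => // j _; have := expn_gt0 2 j; rewrite expnS; lia.
Qed.
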